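(* Let $t$ be a positive integer. Then for every non-negative integer $n$, $$p_{t,t}(n)= p(n)+\sum_{r=1}^{\infty}p\big(n-tr(2r+1)\big)-\sum_{s=1}^{\infty}p\big(n-ts(2s-1)\big)$$ and $$p_{2t,t}(n)= p(n)+\sum_{r=1}^{\infty}p(n-4tr^2)-\sum_{s=1}^{\infty}p\big(n-t(2s-1)^2\big).$$
   Context: $p(n)$ denotes the number of partitions of $n$, with the convention $p(n)=0$ for negative integers $n$ (so the sums are finite). For a partition $\lambda$ and positive integers $A,a$, $\mathrm{mex}_{A,a}(\lambda)$ is the smallest positive integer congruent to $a$ modulo $A$ that is not a part of $\lambda$. For $n\ge 0$, $p_{A,a}(n)$ is the number of partitions $\lambda$ of $n$ with $\mathrm{mex}_{A,a}(\lambda)\equiv a \pmod{2A}$. *)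

(* Defs.v *)
From HB Require Import structures.
From mathcomp Require Import all_boot all_order all_algebra.

Set Implicit Arguments.
Unset Strict Implicit.
Unset Printing Implicit Defensive.

Definition is_partition_of (n : nat) (s : seq nat) : bool :=
  [&& sorted geq s, 0 \notin s & sumn s == n].

Record partition_of (n : nat) := PartitionOf {
  parts :> seq nat;
  partsP : is_partition_of n parts
}.

HB.instance Definition _ n := [isSub for @parts n].
HB.instance Definition _ n := [Countable of partition_of n by <:].

Lemma leq_sumn_mem (s : seq nat) (x : nat) : x \in s -> x <= sumn s.
Proof.
elim: s => //= y s IHs; rewrite in_cons => /orP[/eqP->|/IHs le_xs].
  exact: leq_addr.
exact: leq_trans le_xs (leq_addl _ _).
Qed.

Lemma leq_size_sumn (s : seq nat) : 0 \notin s -> size s <= sumn s.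
Proof.
elim: s => //= y s IHs; rewrite in_cons negb_or eq_sym -lt0n => /andP[y0 /IHs].
by move=> le_s; rewrite -add1n leq_add.
Qed.

(* Finiteness: a partition of n has at most n parts, each at most n *)
Definition partition_code n (l : partition_of n) : n.-bseq 'I_n.+1 :=
  insub_bseq n (map inord l).

Definition partition_decode n (b : n.-bseq 'I_n.+1) : option (partition_of n) :=
  insub (map val b).

Lemma partition_codeK n : pcancel (@partition_code n) (@partition_decode n).
Proof.
move=> l; rewrite /partition_decode /partition_code.
have /and3P[_ l0 /eqP sum_l] := partsP l.
have size_l : size l <= n by rewrite -[X in _ <= X]sum_l leq_size_sumn.
rewrite /insub_bseq val_insubd size_map size_l -map_comp -[RHS]valK.
congr insub.
rewrite -[RHS]map_id; apply/eq_in_map => x lx /=.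
by rewrite inordK // ltnS -sum_l leq_sumn_mem.
Qed.

HB.instance Definition _ n : isFinite (partition_of n) :=
  PCanIsFinite (@partition_codeK n).

Definition npartitions (n : int) : nat :=
  if n is Posz m then #|{: partition_of m}| else 0.

(* The guard 0 < A only serves totality: mex 0 a s = 0 is a dummy value *)
Definition mex_candidate (A a : nat) (s : seq nat) (m : nat) : bool :=
  (0 < A) ==> [&& 0 < m, m == a %[mod A] & m \notin s].

Lemma mex_candidate_ex (A a : nat) (s : seq nat) :
  exists m, mex_candidate A a s m.
Proof.
case: A => [|A]; first by exists 0.
exists ((sumn s).+1 * A.+1 + a); rewrite /mex_candidate /= modnMDl eqxx /=.
apply/negP => /leq_sumn_mem; apply/negP; rewrite -ltnNge.
by apply: leq_trans (leq_addr _ _); rewrite leq_pmulr.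
Qed.

Definition mex (A a : nat) (s : seq nat) : nat :=
  ex_minn (mex_candidate_ex A a s).

Definition npartitions_mex (A a n : nat) : nat :=
  #|[set l : partition_of n | mex A a l == a %[mod 2 * A]]|.

(* Main.v *)
(** For a partition [l] let [j] be the largest number such that
    [a, a + A, .., a + (j-1) A] are all parts of [l]; then the mex of [l] is
    [a + j A], and it is congruent to [a] modulo [2 A] iff [j] is even, that is,
    iff the alternating sum over [k <= j] of [(-1)^k] is [1].  Summing over all
    partitions of [n] and exchanging the two sums gives the alternating sum of
    the numbers of partitions of [n] having [a, .., a + (k-1) A] among their
    parts.  Removing these parts identifies that number with
    [p (n - (k a + A k (k-1) / 2))], and separating even and odd [k] yields both
    formulas. *)
Require Import Defs.
From mathcomp Require Import all_boot all_order all_algebra.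
From mathcomp Require Import classical_sets fsbigop.
From mathcomp Require Import zify ring.

Set Implicit Arguments.
Unset Strict Implicit.
Unset Printing Implicit Defensive.

Import Order.TTheory GRing.Theory Num.Theory.

Local Open Scope ring_scope.
Local Open Scope classical_set_scope.

(** Remove one copy of each element of [s] in turn: since [s] is duplicate-free, its later elements
    differ from [x] and survive in [rem x l]. *)
Lemma perm_cat_subset (T : eqType) (s l : seq T) :
  uniq s -> {subset s <= l} -> exists l', perm_eq l (s ++ l').
Proof.
elim: s l => [|x s IHs] l /=; first by exists l.
case/andP=> xs us sub; have xl : x \in l by apply: sub; rewrite mem_head.
have [|l' pl'] := IHs (rem x l) us.
  move=> y ys; apply: rem_mem; first by apply: contraNneq xs => <-.
  by apply: sub; rewrite inE ys orbT.
by exists l'; rewrite (permPl (perm_to_rem xl)) perm_cons.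
Qed.

Lemma sort_is_partition_of (n : nat) (s : seq nat) :
  0%N \notin s -> sumn s = n -> is_partition_of n (sort geq s).
Proof.
move=> s0 sum_s; apply/and3P; split.
- by apply: sort_sorted => x y; rewrite /geq /=; lia.
- by rewrite mem_sort.
- by rewrite -sum_s; apply/eqP/perm_sumn/permPl/perm_sort.
Qed.

Lemma eq_partition (n : nat) (l1 l2 : partition_of n) :
  perm_eq l1 l2 -> l1 = l2.
Proof.
have [/and3P[s1 _ _] /and3P[s2 _ _]] := (partsP l1, partsP l2).
move=> l12; apply: val_inj; apply: (@sorted_eq _ geq) => // [y x z|x y].
  by rewrite /geq /=; lia.
by rewrite /geq /=; lia.
Qed.

(** Inserting [s] and re-sorting is a bijection from the partitions of [n - sumn s]; its inverse
    removes one copy of each element of [s]. If [sumn s] exceeds [n], both sides are zero. *)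
Lemma card_partitions_containing (n : nat) (s : seq nat) :
  uniq s -> 0%N \notin s ->
  #|[set l : partition_of n | all (mem (parts l)) s]%SET|
    = npartitions (n%:Z - (sumn s)%:Z).
Proof.
move=> us s0; have [le_sn|lt_ns] := leqP (sumn s) n; last first.
  have -> : n%:Z - (sumn s)%:Z = Negz (sumn s - n).-1 by lia.
  apply: eq_card0 => l; rewrite !inE; apply/negP => /allP sl.
  have [l' /perm_sumn] := perm_cat_subset us sl.
  have /and3P[_ _ /eqP ->] := partsP l.
  by rewrite sumn_cat; lia.
rewrite subzn //=; set m := (n - sumn s)%N.
have f_subproof (l : partition_of m) :
    is_partition_of n (sort geq (s ++ parts l)).
  have /and3P[_ l0 /eqP sum_l] := partsP l.
  by apply: sort_is_partition_of; rewrite ?mem_cat ?negb_or ?s0 // sumn_cat; lia.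
pose f l := PartitionOf (f_subproof l).
have permf l : perm_eq (parts (f l)) (s ++ parts l) by rewrite /= perm_sort.
have f_inj : injective f.
  move=> l1 l2 e; apply: eq_partition; rewrite -(perm_cat2l s).
  by rewrite -(permPl (permf l1)) e permf.
rewrite -cardsT -(card_imset _ f_inj); apply: eq_card => l; rewrite !inE.
apply/idP/imsetP => [/allP sl|[l' _ ->]]; last first.
  by apply/allP => x xs; rewrite /= (perm_mem (permf l')) mem_cat xs.
have [l' pl'] := perm_cat_subset us sl.
have /and3P[_ l0 /eqP sum_l] := partsP l.
have l'P : is_partition_of m (sort geq l').
  apply: sort_is_partition_of.
    by move: l0; rewrite (perm_mem pl') mem_cat negb_or => /andP[].
  by move/perm_sumn: pl'; rewrite sumn_cat; lia.
exists (PartitionOf l'P) => //; apply: eq_partition.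
by rewrite (permPl pl') perm_sym (permPl (permf _)) perm_cat2l /= perm_sort.
Qed.

(** The bounds on [a] make it the least positive integer of its class, so the mex candidates lie on
    this progression. *)
Lemma mex_progression (A a : nat) (s : seq nat) : (0 < a <= A)%N ->
  exists2 j, mex A a s = (a + j * A)%N
    & forall k, all (mem s) (mkseq (fun i => a + i * A)%N k) = (k <= j)%N.
Proof.
case/andP=> a0 aA; have A0 := leq_trans a0 aA.
rewrite /mex; case: ex_minnP => m; rewrite /mex_candidate A0 /=.
case/and3P=> m0 /eqP mod_m ms min_m.
have [j mE] : exists j, m = (a + j * A)%N.
  (* If [m < a], then [m] is its own residue, while [a] has residue [a], or 0 when [a = A]; both
     contradict [0 < m < a]. *)
  have le_am : (a <= m)%N.
    rewrite leqNgt; apply/negP => lt_ma; move: mod_m.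
    rewrite modn_small ?(leq_trans lt_ma) //.
    move: aA; rewrite leq_eqVlt => /orP[/eqP->|ltaA]; first by rewrite modnn; lia.
    by rewrite modn_small //; lia.
  exists ((m - a) %/ A)%N; rewrite divnK ?subnKC //.
  by rewrite -eqn_mod_dvd // mod_m.
subst m; exists j => // k; apply/allP/idP => [ks|le_kj x].
  rewrite leqNgt; apply: contra ms => lt_jk.
  by apply: ks; apply/mapP; exists j => //; rewrite mem_iota.
case/mapP=> i; rewrite mem_iota /= add0n => lt_ik ->; apply/negPn/negP => is'.
have := min_m (a + i * A)%N.
rewrite addn_gt0 a0 addnC modnMDl eqxx addnC is' => /(_ isT).
by rewrite leq_add2l leq_pmul2r // leqNgt (leq_trans lt_ik).
Qed.

(** The sum is [k a + A k (k-1) / 2], doubled and with the negative term moved left to stay in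
    [nat]. *)
Lemma sumn_progression (A a k : nat) :
  (2 * sumn (mkseq (fun i => a + i * A) k) + k * A = 2 * k * a + k * k * A)%N.
Proof.
elim: k => [|k IHk]; first by rewrite !mul0n.
by move: IHk; rewrite mkseqS sumn_rcons; lia.
Qed.

(** Only [minn N j.+1] terms survive, and alternating signs starting from 1 cancel in pairs. *)
Lemma alternating_sum_leq (j N : nat) :
  \sum_(k < N) (-1) ^+ k * (k <= j)%:Z = (odd (minn N j.+1))%:Z :> int.
Proof.
elim: N => [|N IHN]; first by rewrite big_ord0 min0n.
rewrite big_ord_recr /= IHN -signr_odd.
have [le_Nj|lt_jN] := leqP N j; last by rewrite mulr0 addr0; congr (odd _)%:Z; lia.
rewrite (minn_idPl _) ?(minn_idPl _) //; last by lia.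
by rewrite /=; case: (odd N).
Qed.

Lemma npartitions_mex_alternating (A a n N : nat) : (0 < a <= A)%N ->
  (n < N)%N ->
  (npartitions_mex A a n)%:Z
    = \sum_(k < N) (-1) ^+ k *
        (npartitions (n%:Z - (sumn (mkseq (fun i => a + i * A)%N k))%:Z))%:Z.
Proof.
move=> aA lt_nN; have /andP[a0 le_aA] := aA.
pose S k := mkseq (fun i => a + i * A)%N k.
have uniqS k : uniq (S k).
  by rewrite map_inj_uniq ?iota_uniq // => i j; nia.
have S0 k : 0%N \notin S k.
  by apply/negP => /mapP[i _]; lia.
rewrite /npartitions_mex -sum1_card -natz raddf_sum /=.
transitivity (\sum_(l : partition_of n) \sum_(k < N)
    (-1) ^+ k * (all (mem (parts l)) (S k))%:Z : int); last first.
  rewrite exchange_big /=; apply: eq_bigr => k _.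
  rewrite -card_partitions_containing // -mulr_sumr; congr (_ * _).
  rewrite -sum1_card -natz raddf_sum /= [RHS]big_mkcond /=; apply: eq_bigr => l _.
  by rewrite inE; case: all.
rewrite big_mkcond /=; apply: eq_bigr => l _; rewrite inE.
have [j -> Sj] := mex_progression (parts l) aA.
under eq_bigr do rewrite Sj.
rewrite alternating_sum_leq.
(* For positive [j], the part [a + (j-1) A] is at least [j] and at most [n], so the truncation at
   [N] loses nothing. *)
have lt_jN : (j < N)%N.
  have /and3P[_ _ /eqP sum_l] := partsP l.
  case: j Sj => [|j] Sj; first by lia.
  have /allP/(_ (a + j * A)%N) : all (mem (parts l)) (S j.+1) by rewrite Sj.
  have -> : (a + j * A)%N \in S j.+1 by apply/mapP; exists j; rewrite ?mem_iota /=.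
  by move=> /(_ isT) /leq_sumn_mem; nia.
(* What remains is that [2 * A] divides [j * A] exactly when [j] is even. *)
rewrite (minn_idPr lt_jN) /= -[X in _ == X %[mod _]]addn0 eqn_modDl mod0n.
by rewrite -/(dvdn _ _) dvdn_pmul2r ?(leq_trans a0) // dvdn2; case: odd.
Qed.

(** A sum over a set defaults to 0 on infinite support; vanishing beyond [N] rules this out. *)
Lemma fsum_pos_nat (F : nat -> int) (N : nat) :
  (forall r, (N < r)%N -> F r = 0) ->
  \sum_(r \in [set r : nat | (0 < r)%N]) F r = \sum_(r < N) F r.+1.
Proof.
move=> F0; rewrite (fsbigE (iota 1 N)) ?iota_uniq //=.
- rewrite (iotaDl 1 0) big_map -(big_mkord xpredT (fun r => F r.+1)).
  by rewrite /index_iota subn0; apply: eq_bigl => i; rewrite mem_set.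
- by move=> r /=; rewrite mem_iota => /andP[].
- by move=> r /= r0; rewrite mem_iota r0 add1n ltnS -ltnNge => /F0.
Qed.

Lemma alternating_sum_even_odd (G : nat -> int) (N : nat) :
  \sum_(k < (2 * N).+1) (-1) ^+ k * G k
    = G 0%N + \sum_(r < N) G (2 * r.+1)%N - \sum_(s < N) G (2 * s.+1 - 1)%N.
Proof.
elim: N => [|N IHN].
  by rewrite big_ord_recr !big_ord0 /= expr0 mul1r add0r addr0 subr0.
have -> : ((2 * N.+1).+1 = (2 * N).+3)%N by lia.
rewrite [LHS]big_ord_recr [in LHS]big_ord_recr /= IHN !big_ord_recr /=.
have -> : (2 * N.+1 - 1 = (2 * N).+1)%N by lia.
have -> : (2 * N.+1 = (2 * N).+2)%N by lia.
by rewrite !exprS mulnC exprM sqrr_sign; ring.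
Qed.

Lemma npartitions_mex_fsum (A a n : nat) : (0 < a <= A)%N ->
  let S k := (sumn (mkseq (fun i => a + i * A)%N k))%:Z in
  (npartitions_mex A a n)%:Z = (npartitions n%:Z)%:Z
    + \sum_(r \in [set r : nat | (0 < r)%N]) (npartitions (n%:Z - S (2 * r)%N))%:Z
    - \sum_(s \in [set s : nat | (0 < s)%N])
        (npartitions (n%:Z - S (2 * s - 1)%N))%:Z.
Proof.
move=> aA S; have vanish k : (n < k)%N -> (npartitions (n%:Z - S k))%:Z = 0.
  move=> lt_nk; have := sumn_progression A a k; rewrite /S.
  set m := sumn _ => E; have -> // : n%:Z - m%:Z = Negz (m - n).-1.
  (* All [k] summands are positive, so their sum is at least [k]. *)
  suff : (k <= m)%N by lia.
  nia.
(* An odd number of terms leaves [n] even and [n] odd indices besides 0; for [r > n] both [2 r] and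
   [2 r - 1] exceed [n]. *)
rewrite (@npartitions_mex_alternating _ _ _ (2 * n).+1) //; last by lia.
rewrite (alternating_sum_even_odd (fun k => (npartitions (n%:Z - S k))%:Z)).
rewrite (fsum_pos_nat (N := n)) => [|r lt_nr]; last by apply: vanish; lia.
rewrite (fsum_pos_nat (N := n)) => [|r lt_nr]; last by apply: vanish; lia.
by have -> : n%:Z - S 0%N = n%:Z by rewrite /S /=; lia.
Qed.

Theorem theorem2p1 (t : nat) (t_gt0 : (0 < t)%N) (n : nat) :
  (npartitions_mex t t n)%:Z =
    (npartitions n%:Z)%:Z
    + \sum_(r \in [set r : nat | (0 < r)%N])
        (npartitions (n%:Z - t%:Z * r%:Z * (2 * r%:Z + 1)))%:Z
    - \sum_(s \in [set s : nat | (0 < s)%N])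
        (npartitions (n%:Z - t%:Z * s%:Z * (2 * s%:Z - 1)))%:Z
  /\
  (npartitions_mex (2 * t) t n)%:Z =
    (npartitions n%:Z)%:Z
    + \sum_(r \in [set r : nat | (0 < r)%N])
        (npartitions (n%:Z - 4 * t%:Z * r%:Z ^+ 2))%:Z
    - \sum_(s \in [set s : nat | (0 < s)%N])
        (npartitions (n%:Z - t%:Z * (2 * s%:Z - 1) ^+ 2))%:Z.
Proof.
split; rewrite npartitions_mex_fsum ?t_gt0 ?leqnn ?leq_pmull //=;
  congr (_ + _ - _); apply: eq_fsbigr => r; rewrite inE /= => r0;
  congr (npartitions (_ - _))%:Z.
(* The sum of the first [k] terms is [t k (k+1) / 2] for modulus [t] and [t k^2] for modulus
   [2 * t]. *)
- by have := sumn_progression t t (2 * r); lia.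
- by have := sumn_progression t t (2 * r - 1); nia.
- by have := sumn_progression (2 * t) t (2 * r); nia.
- by have := sumn_progression (2 * t) t (2 * r - 1); nia.
Qed.
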